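(* Let $X$ be a finite set and $I$ an ideal of $Di[X]$. Then for any monomial-center ordering on $\lfloor X^+\rfloor_1\cup\lfloor XX\rfloor_2$, $I$ has a finite Gröbner--Shirshov basis.
   Context: Fix a field $\mathbf{k}$. A commutative dialgebra is a $\mathbf{k}$-linear space with two bilinear operations $\vdash,\dashv$, each associative and commutative, satisfying $a\dashv(b\vdash c)=a\dashv(b\dashv c)$, $(a\dashv b)\vdash c=(a\vdash b)\vdash c$, $a\vdash(b\dashv c)=(a\vdash b)\dashv c$. An ideal is a subspace closed under multiplication (by $\vdash$ and by $\dashv$) with arbitrary elements; $Id(S)$ is the ideal generated by $S$. Let $X$ be a totally ordered set, $\lfloor X^+\rfloor$ the free commutative semigroup without unit on $X$ (elements $\lfloor u\rfloor$, length $|u|$), $\lfloor X^*\rfloor=\lfloor X^+\rfloor\cup\{\varepsilon\}$ the free commutative monoid. Let $\lfloor X^+\rfloor_1=\{\lfloor u\rfloor_1\mid\lfloor u\rfloor\in\lfloor X^+\rfloor\}$ and $\lfloor XX\rfloor_2=\{\lfloor v\rfloor_2\mid\lfloor v\rfloor\in\lfloor X^+\rfloor,|v|=2\}$ (formal symbols); $x\in X$ is identified with $\lfloor x\rfloor_1$. $Di[X]$ is the free commutative dialgebra generated by $X$: the $\mathbf{k}$-space with basis $\lfloor X^+\rfloor_1\cup\lfloor XX\rfloor_2$ and operations: for $x,x'\in X$, $x\dashv x'=\lfloor xx'\rfloor_1$, $x\vdash x'=\lfloor xx'\rfloor_2$; and if $|uv|>2$, $\lfloor u\rfloor_p\vdash\lfloor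 v\rfloor_q=\lfloor u\rfloor_p\dashv\lfloor v\rfloor_q=\lfloor uv\rfloor_1$. Ordering. A monomial ordering on $\lfloor X^+\rfloor$ is a well (total) ordering with $\lfloor u\rfloor>\lfloor v\rfloor\Rightarrow\lfloor uw\rfloor>\lfloor vw\rfloor$. The associated monomial-center ordering on $\lfloor X^+\rfloor_1\cup\lfloor XX\rfloor_2$ is: $\lfloor u\rfloor_m>\lfloor v\rfloor_n$ iff $(\lfloor u\rfloor,m)>(\lfloor v\rfloor,n)$ lexicographically. For nonzero $f\in Di[X]$: $supp(f)$ is the set of basis elements occurring with nonzero coefficient; $\overline f$ its largest element (leading monomial), $lc(f)$ its coefficient; $\widetilde f\in\lfloor X^+\rfloor$ is the word $\lfloor u\rfloor$ if $\overline f=\lfloor u\rfloor_m$; $r_f=f-lc(f)\overline f$. Convention: $\overline 0=\widetilde 0=0$ is smaller than everything. $f$ is monic if $lc(f)=1$; a set is monic if all its elements are. $f\ne0$ is strong if $\widetilde f>\widetilde{r_f}$. Normal polynomials. For a monic set $S$ the normal $S$-polynomials (normal $s$-polynomials, $s\in S$) $\lfloor sb\rfloor_m$ ($\lfloor b\rfloor\in\lfloor X^*\rfloor$, $m\in\{1,2\}$) are: $\lfloor sb\rfloor_m=s$ if $b=\varepsilon$ ($m$ being the index of $\overline s$); $\lfloor sb\rfloor_2=s\vdash b$ if $|\widetilde s|=1$ and $b\in X$; $\lfloor sb\rfloor_1=s\dashv\lfloor b\rfloor_1$ if $s$ is strong and $\lfloor b\rfloor\in\lfloor X^+\rfloor$.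 Compositions of monic $f,g\in Di[X]$: (i) if $f$ is not strong, for each $x\in X$, $f\vdash x$ and $f\dashv x$; (ii) if $f$ is strong, $|\widetilde f|>1$ and $supp(f)\cap X\ne\emptyset$, for each $x\in X$, $(f\vdash x)-(f\dashv x)$; (iii) if $f\neq g$, $\overline f=\overline g$: $f-g$; (iv) if $|\widetilde f|=2$, $|\widetilde g|=1$ and there is a normal $g$-polynomial $\lfloor gx\rfloor_m$, $x\in X$, with $\overline f=\overline{\lfloor gx\rfloor_m}$: $f-\lfloor gx\rfloor_m$; (v) if $f,g$ are strong, $|\widetilde f|+|\widetilde g|>3$, $\overline f\ne\overline g$: when $\widetilde f=\widetilde g$, for each $x\in X$, $\lfloor fx\rfloor_1-\lfloor gx\rfloor_1$; when $\widetilde f\neq\widetilde g$ and $lcm\{\widetilde f,\widetilde g\}=\lfloor w\rfloor=\lfloor\widetilde fa\rfloor=\lfloor\widetilde gb\rfloor$ with $\lfloor a\rfloor\in\lfloor X^*\rfloor$, $\lfloor b\rfloor\in\lfloor X^+\rfloor$, $|w|<|\widetilde f|+|\widetilde g|$: $\lfloor fa\rfloor_1-\lfloor gb\rfloor_1$. $h\in Di[X]$ is trivial modulo $S$ if $h=\sum_i\alpha_i\lfloor s_ib_i\rfloor_{m_i}$ (finite sum, $\alpha_i\in\mathbf{k}$, normal $S$-polynomials) with $\overline{\lfloor s_ib_i\rfloor_{m_i}}\le\overline h$ whenever $\alpha_i\ne0$. A monic set $S$ is a Gröbner--Shirshov basis in $Di[X]$ if every composition of polynomials in $S$ is trivial modulo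 $S$; it is then called a Gröbner--Shirshov basis for $I=Id(S)$. *)

(* Defs.v *)
(* MathComp, with finmap and multinomials' monalg: {cmonom X} is the free
   commutative monoid on X and {malg k[B]} the free k-module on B. *)
From HB Require Import structures.
From mathcomp Require Import all_boot all_algebra finmap.
From mathcomp Require Export monalg.

Set Implicit Arguments.
Unset Strict Implicit.
Unset Printing Implicit Defensive.

Import GRing.Theory.
Local Open Scope fset_scope.
Local Open Scope ring_scope.

(* The free commutative semigroup without unit: an element of the free
   commutative monoid other than its unit. *)
Record cword (X : choiceType) : predArgType :=
  CWord { cword_val :> {cmonom X}; _ : cword_val != mone }.

HB.instance Definition _ (X : choiceType) := [isSub for @cword_val X].
HB.instance Definition _ (X : choiceType) := [Choice of cword X by <:].

Section Words.
Context {X : choiceType}.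
Implicit Types (x : X) (u v : cword X) (m n : {cmonom X}).

Fact cgen_subproof x : ucm x != mone.
Proof. by rewrite -mdeg_eq0 mdegU. Qed.
Definition cgen x : cword X := CWord (cgen_subproof x).

Fact cmul_subproof u v : mmul (u : {cmonom X}) v != mone.
Proof.
by apply/unitmP => -[u1 _]; move: (valP u); rewrite /= u1.
Qed.
Definition cmul u v : cword X := CWord (cmul_subproof u v).

Definition mlcm m n : {cmonom X} :=
  [cmonom maxn (m x) (n x) | x in finsupp m `|` finsupp n]%M.

Lemma mlcmE m n x : mlcm m n x = maxn (m x) (n x).
Proof.
rewrite /mlcm cmE fsfunE in_fsetU; case: ifP => // /negbT.
by rewrite negb_or => /andP[mx nx]; rewrite !fsfun_dflt.
Qed.

End Words.

(* The linear basis of Di[X]: inl u is the symbol [u]_1, inr v is [v]_2. *)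
Definition dimon (X : choiceType) : Type :=
  (cword X + {v : cword X | mdeg v == 2%N})%type.

HB.instance Definition _ (X : choiceType) := Choice.on (dimon X).

Notation Di k X := {malg k[dimon X]}.

Section Dialgebra.
Context {k : fieldType} {X : choiceType}.
Implicit Types (x : X) (a b : dimon X) (f g h s : Di k X).
Implicit Types (I J S : Di k X -> Prop).

Definition dword a : cword X :=
  match a with inl u => u | inr v => val v end.

Definition dindex a : nat := match a with inl _ => 1%N | inr _ => 2%N end.

Definition bleft a b : dimon X := inl (cmul (dword a) (dword b)).

Definition bright a b : dimon X :=
  let w := cmul (dword a) (dword b) in
  match insub w with Some v => inr v | None => inl w end.

Definition bilin_ext (op : dimon X -> dimon X -> dimon X) f g : Di k X :=
  \sum_(a <- msupp f) \sum_(b <- msupp g) << f@_a * g@_b *g op a b >>.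

(* f -| g and f |- g *)
Definition dleft := bilin_ext bleft.
Definition dright := bilin_ext bright.

(* [u]_1 as an element of Di[X], and the identification of x with [x]_1 *)
Definition dw1 (u : cword X) : Di k X := << (inl u : dimon X) >>.
Definition dgen x : Di k X := dw1 (cgen x).

Definition ideal I : Prop :=
  [/\ I 0,
      forall f g, I f -> I g -> I (f + g),
      forall (c : k) f, I f -> I (c *: f) &
      forall f g, I f ->
        [/\ I (dleft f g), I (dleft g f), I (dright f g) & I (dright g f)]].

Definition ideal_gen S f : Prop :=
  forall J, ideal J -> (forall g, S g -> J g) -> J f.

End Dialgebra.

(* An ordering is given by its non-strict part. *)
Definition strict (T : eqType) (le : rel T) : rel T :=
  fun x y => (x != y) && le x y.

Record monomial_ordering (X : choiceType) (le : rel (cword X)) : Prop := {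
  mo_refl : reflexive le;
  mo_anti : antisymmetric le;
  mo_trans : transitive le;
  mo_total : total le;
  mo_well : forall P : cword X -> Prop, (exists u, P u) ->
    exists2 u, P u & forall v, P v -> le u v;
  mo_mul : forall u v w : cword X,
    strict le v u -> strict le (cmul v w) (cmul u w)
}.

(* None plays the role of 0, smaller than everything. *)
Definition ole (T : Type) (le : rel T) : rel (option T) := fun x y =>
  match x, y with
  | None, _ => true
  | Some _, None => false
  | Some x', Some y' => le x' y'
  end.

Section GroebnerShirshov.
Context {k : fieldType} {X : choiceType} (le : rel (cword X)).
Implicit Types (x : X) (a : dimon X) (f g h s : Di k X).
Implicit Types (I S : Di k X -> Prop).

Definition mcle : rel (dimon X) := fun a a' =>
  strict le (dword a) (dword a') ||
  (dword a == dword a') && (dindex a <= dindex a')%N.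

(* The greatest element of supp f; None exactly when f = 0, for le a
   monomial ordering. *)
Definition lm f : option (dimon X) :=
  ohead [seq a <- msupp f | all (mcle^~ a) (msupp f)].

Definition lc f : k := if lm f is Some a then f@_a else 0.

Definition lword f : option (cword X) := omap dword (lm f).

Definition lsize f : nat := if lword f is Some u then mdeg u else 0%N.

Definition rest f : Di k X :=
  if lm f is Some a then f - lc f *: << a >> else 0.

Definition monic f : Prop := lc f = 1.

Definition strong f : bool :=
  (f != 0) && strict (ole le) (lword (rest f)) (lword f).

(* normal_poly s b m p: the normal s-polynomial [s b]_m is defined, and
   equals p. *)
Inductive normal_poly s : {cmonom X} -> nat -> Di k X -> Prop :=
| NormalUnit a of lm s = Some a : normal_poly s mone (dindex a) s
| NormalRight x of lsize s = 1%N : normal_poly s (cgen x) 2 (dright s (dgen x))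
| NormalLeft (b : cword X) of strong s : normal_poly s b 1 (dleft s (dw1 b)).

(* The first three constructors do not involve g.  In CompLcm, p and q are
   [f a]_1 and [g b]_1. *)
Inductive composition f g : Di k X -> Prop :=
| CompRight x of ~~ strong f : composition f g (dright f (dgen x))
| CompLeft x of ~~ strong f : composition f g (dleft f (dgen x))
| CompStrong x of strong f & (1 < lsize f)%N
    & (exists y : X, (inl (cgen y) : dimon X) \in msupp f) :
    composition f g (dright f (dgen x) - dleft f (dgen x))
| CompEq of f <> g & lm f = lm g : composition f g (f - g)
| CompNormal x m p of lsize f = 2%N & lsize g = 1%N
    & normal_poly g (cgen x) m p & lm f = lm p :
    composition f g (f - p)
| CompSameWord x p q of strong f & strong g & (3 < lsize f + lsize g)%N
    & lm f <> lm g & lword f = lword g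
    & normal_poly f (cgen x) 1 p & normal_poly g (cgen x) 1 q :
    composition f g (p - q)
| CompLcm (u v b : cword X) (a : {cmonom X}) p q
    of strong f & strong g & (3 < lsize f + lsize g)%N & lm f <> lm g
    & lword f = Some u & lword g = Some v & u <> v
    & mlcm u v = mmul (u : {cmonom X}) a
    & mlcm u v = mmul (v : {cmonom X}) b
    & (mdeg (mlcm u v) < mdeg u + mdeg v)%N
    & normal_poly f a 1 p & normal_poly g b 1 q :
    composition f g (p - q).

Definition trivial_mod S h : Prop :=
  exists l : seq (k * Di k X),
    (forall c p, (c, p) \in l ->
       (exists (s : Di k X) (b : {cmonom X}) (m : nat),
          S s /\ normal_poly s b m p) /\
       (c != 0 -> ole mcle (lm p) (lm h))) /\
    h = \sum_(cp <- l) cp.1 *: cp.2.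

Definition GS_basis S : Prop :=
  (forall s, S s -> monic s) /\
  (forall f g h, S f -> S g -> composition f g h -> trivial_mod S h).

Definition GS_basis_for S I : Prop :=
  GS_basis S /\ (forall f, I f <-> ideal_gen S f).

End GroebnerShirshov.

(* Main.v *)
Require Import Defs.
From mathcomp Require Import all_boot all_algebra finmap zify.
From Stdlib Require Import Classical.

Set Implicit Arguments.
Unset Strict Implicit.
Unset Printing Implicit Defensive.

Import GRing.Theory.
Local Open Scope ring_scope.

(** Every ideal I has a finite set S of monic elements whose normal polynomials
    realise all leading monomials of I.  This is enough: normal S-polynomials
    lie in I, so dividing h in I by them, one leading monomial after the other,
    stays in I and stops at 0 because the monomial-center ordering is a well
    ordering.  Thus every element of I is trivial modulo S
    ([trivial_mod_cover]).  In particular S generates I; and since the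
    compositions of elements of S are themselves in I, they are all trivial,
    whatever their shape.

    The set S exists by Dickson's lemma ([finite_lm_cover]).  Only finitely
    many leading monomials have length at most 2, and S contains a polynomial
    for each of them.  From length 3 on there are no symbols of index 2, so a
    monomial of this length that leads a polynomial shares its word with no
    other: the polynomial is strong ([strong_long]).  Its left products with
    words are then normal, and their leading words are all the proper multiples
    of its own ([lm_dleft]), so that it is enough to represent the leading words
    minimal for divisibility. *)

(** * Dickson's lemma *)

(** Since n <= m and N - n <= N - m force n = m when m, n <= N, a list es that
    contains both a bounded function and its complement selects
    representatives within each of its level sets. *)
Lemma dickson (T : eqType) (es : seq (T -> nat)) (P : T -> Prop) :
  exists2 l : seq T, (forall t, t \in l -> P t) &
    forall t, P t -> exists2 s, s \in l & all (fun e => e s <= e t)%N es.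
Proof.
elim: es P => [|e es IHes] P.
  have [[t Pt]|noP] := classic (exists t, P t); last first.
    by exists [::] => // t Pt; case: noP; exists t.
  exists [:: t]; first by move=> s; rewrite inE => /eqP->.
  by move=> s _; exists t; rewrite ?inE.
(* An element that no member of l dominates has a bounded value of e, so that
   it falls into one of finitely many slices on which e is constant. *)
have [l lP ldom] := IHes P.
have slices n : exists2 l' : seq T, (forall t, t \in l' -> P t) &
    forall t, P t -> (e t < n)%N ->
      exists2 s, s \in l' & all (fun e => e s <= e t)%N (e :: es).
  elim: n => [|n [l1 l1P l1dom]]; first by exists [::].
  have [l2 l2P l2dom] := IHes (fun t => P t /\ e t = n).
  exists (l1 ++ l2) => [t|t Pt].
    by rewrite mem_cat => /orP[/l1P//|/l2P[]].
  rewrite ltnS leq_eqVlt => /predU1P[etn|ltn].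
    have [s sl2 sdom] := l2dom t (conj Pt etn).
    exists s; first by rewrite mem_cat sl2 orbT.
    by rewrite /= sdom andbT; case: (l2P s sl2) => _ ->; rewrite etn.
  have [s sl1 sdom] := l1dom t Pt ltn.
  by exists s => //; rewrite mem_cat sl1.
have [l' l'P l'dom] := slices (\max_(t <- l) e t)%N.
exists (l ++ l') => [t|t Pt].
  by rewrite mem_cat => /orP[/lP|/l'P].
have [small|big] := ltnP (e t) (\max_(t <- l) e t)%N.
  by have [s sl' sdom] := l'dom t Pt small; exists s; rewrite // mem_cat sl' orbT.
have [s sl sdom] := ldom t Pt.
exists s; first by rewrite mem_cat sl.
by rewrite /= sdom andbT (leq_trans _ big) //; apply: leq_bigmax_seq.
Qed.

(** * Words and basis elements *)

Lemma cmonom_dvd (X : choiceType) (m n : {cmonom X}) :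
  (forall x, m x <= n x)%N -> exists b : {cmonom X}, n = mmul m b.
Proof.
move=> mn; exists (divcm n m).
by apply/eqP/cmP => x; rewrite cmM divcmE subnKC.
Qed.

Lemma cmulI (X : choiceType) (u v w : cword X) :
  cmul u w = cmul v w -> u = v.
Proof.
move=> /(congr1 (@cword_val X)) /= uw; apply/val_inj/eqP/cmP => x /=.
have /(congr1 (fun m : {cmonom X} => m x)) := uw.
by rewrite !cmM => /eqP; rewrite eqn_add2r => /eqP.
Qed.

Lemma dimon_eq (X : choiceType) (a b : dimon X) :
  dword a = dword b -> dindex a = dindex b -> a = b.
Proof. by case: a b => [u|u] [v|v] //= => [->|/val_inj ->]. Qed.

Lemma dindex_long (X : choiceType) (a : dimon X) :
  (2 < mdeg (dword a))%N -> dindex a = 1%N.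
Proof. by case: a => [//|[v /eqP vdeg]] /=; rewrite vdeg. Qed.

(** * The monomial-center ordering *)

Section Ordering.
Context (X : choiceType) (le : rel (cword X)) (leP : monomial_ordering le).
Implicit Types (a b c : dimon X) (u v w : cword X).

Let le_refl u : le u u := mo_refl leP u.
Let le_tr := mo_trans leP.

Lemma mcle_word a b : mcle le a b -> le (dword a) (dword b).
Proof. by case/orP => [/andP[]|/andP[/eqP->]]. Qed.

Lemma mcleE a b : mcle le a b =
  le (dword a) (dword b) && ((dword a == dword b) ==> (dindex a <= dindex b)%N).
Proof.
rewrite /mcle /strict; case: eqP => [->|] /=; first by rewrite le_refl.
by rewrite orbF andbT.
Qed.

Lemma mcle_refl a : mcle le a a.
Proof. by rewrite mcleE le_refl eqxx /=. Qed.

Lemma mcle_trans : transitive (mcle le).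
Proof.
move=> b a c; rewrite !mcleE => /andP[ab iab] /andP[bc ibc].
rewrite (le_tr ab bc); apply/implyP => /eqP ac.
have eab : dword a = dword b by apply: (mo_anti leP); rewrite ab ac bc.
move: iab ibc; rewrite -ac eab eqxx /=; exact: leq_trans.
Qed.

Lemma mcle_anti a b : mcle le a b -> mcle le b a -> a = b.
Proof.
rewrite !mcleE => /andP[ab iab] /andP[ba iba].
have eab : dword a = dword b by apply: (mo_anti leP); rewrite ab ba.
apply: dimon_eq => //; move: iab iba; rewrite eab eqxx /= => iab iba.
by apply/eqP; rewrite eqn_leq iab.
Qed.

Lemma mcle_total a b : mcle le a b || mcle le b a.
Proof.
rewrite !mcleE; case: (eqVneq (dword a)) => [->|ne] /=.
  by rewrite le_refl /= leq_total.
by rewrite !andbT (mo_total leP).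
Qed.

(** Well-founded induction: below a given word the well ordering on words
    applies, and a word carries at most two basis elements. *)
Lemma mcle_ind (Q : dimon X -> Prop) :
  (forall a, (forall b, b != a -> mcle le b a -> Q b) -> Q a) -> forall a, Q a.
Proof.
move=> step a; apply: NNPP => nQa.
have [|u [c [cu nQc]] umin] :=
    mo_well leP (P := fun u => exists c, dword c = u /\ ~ Q c).
  by exists (dword a), a.
have below b : le (dword b) u -> dword b != u -> Q b.
  move=> bu ne; apply: NNPP => nQb; case/eqP: ne; apply: (mo_anti leP).
  by rewrite bu umin //; exists b.
have at_u n b : dword b = u -> (dindex b <= n)%N -> Q b.
  elim: n b => [|n IHn] b bu bn; first by case: (b) bn.
  apply: step => d dNb; rewrite mcleE bu => /andP[du].
  case: eqVneq => [eu /= idb|ne _]; last exact: below.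
  apply: IHn => //; rewrite -ltnS; apply: leq_trans bn; rewrite ltn_neqAle idb.
  by rewrite andbT; apply: contra dNb => /eqP/dimon_eq->; rewrite ?bu.
exact: nQc (at_u _ _ cu (leqnn _)).
Qed.

End Ordering.

(** * Leading monomials *)

Section LeadingMonomial.
Context (k : fieldType) (X : choiceType) (le : rel (cword X)).
Context (leP : monomial_ordering le).
Implicit Types (a b c : dimon X) (f g h p s : Di k X).

Lemma lmP f a :
  lm le f = Some a <-> a \in msupp f /\ (forall b, b \in msupp f -> mcle le b a).
Proof.
have greatest b : (b \in [seq a <- msupp f | all (mcle le ^~ a) (msupp f)]) <->
    b \in msupp f /\ (forall c, c \in msupp f -> mcle le c b).
  rewrite mem_filter; split=> [/andP[/allP ball bf]|[bf ball]] //.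
  by rewrite bf andbT; apply/allP.
rewrite /lm; split=> [lma|afP].
  by apply/greatest; case: filter lma => //= c r [->]; rewrite mem_head.
have /greatest := afP; case: filter greatest => //= c r greatest _; congr Some.
have /greatest[cf cmax] : c \in c :: r by rewrite mem_head.
by case: afP => af amax; apply: (mcle_anti leP); [apply: amax|apply: cmax].
Qed.

Lemma mcle_max (r : seq (dimon X)) a0 : a0 \in r ->
  exists2 a, a \in r & {in r, forall b, mcle le b a}.
Proof.
elim: r a0 => // a [|a1 r] IHr a0 _.
  by exists a; rewrite ?mem_head // => b; rewrite inE => /eqP->; apply: mcle_refl.
have [b br bmax] := IHr a1 (mem_head _ _).
have [ab|ba] := orP (mcle_total leP a b).
  by exists b; [rewrite inE br orbT | move=> c; rewrite inE => /predU1P[->|/bmax]].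
exists a; rewrite ?mem_head // => c; rewrite inE => /predU1P[->|/bmax cb].
  exact: mcle_refl.
exact: (mcle_trans leP) cb ba.
Qed.

Lemma lm_exists f : f != 0 -> exists a, lm le f = Some a.
Proof.
move=> f0; have /fset0Pn[a0 /mcle_max[a af amax]] : msupp f != fset0.
  apply: contra_neq f0 => supp0; apply/malgP => a.
  by rewrite mcoeff0 mcoeff_outdom // supp0 in_fset0.
by exists a; apply/lmP.
Qed.

Lemma lm_eq0 f : lm le f = None -> f = 0.
Proof. by move=> lmf; apply: contraPeq lmf => /lm_exists[a ->]. Qed.

Lemma lm_neq0 f a : lm le f = Some a -> f@_a != 0.
Proof. by move=> /lmP[af _]; rewrite mcoeff_neq0. Qed.

Lemma lm_cancel f p a : lm le f = Some a -> lm le p = Some a ->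
  forall b, lm le (f - (f@_a / p@_a) *: p) = Some b -> b != a /\ mcle le b a.
Proof.
move=> lmf lmp b /lmP[bfp _]; split.
  apply: contraTneq bfp => ->.
  by rewrite -mcoeff_eq0 mcoeffB mcoeffZ divfK ?subrr // (lm_neq0 lmp).
have [/lmP[_ fmax] /lmP[_ pmax]] := (lmf, lmp).
have := fsubsetP (msuppB_le _ _) _ bfp; rewrite in_fsetU => /orP[/fmax //|].
by move/(fsubsetP (msuppZ_le _ _)); apply: pmax.
Qed.

Lemma lmZ (z : k) f : z != 0 -> lm le (z *: f) = lm le f.
Proof. by move=> z0; rewrite /lm msuppZ (negPf z0). Qed.

(** Being strong constrains only the leading word of the rest; as [mcle]
    refines the ordering of words, this bounds all the other words. *)
Lemma strongP f a : lm le f = Some a ->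
  strong le f <->
  forall b, b \in msupp f -> b != a -> strict le (dword b) (dword a).
Proof.
move=> lmf; have /lmP[af amax] := lmf.
have restE b : b \in msupp (rest le f) = (b \in msupp f) && (b != a).
  rewrite /rest /lc lmf -!mcoeff_neq0 mcoeffB mcoeffZ mcoeffU (eq_sym a b).
  have [->|ne] := eqVneq b a; first by rewrite mulr1 subrr eqxx andbF.
  by rewrite mulr0 subr0 andbT.
have f0 : f != 0 by apply: contraTneq af => ->; rewrite msupp0 in_fset0.
rewrite /strong f0 /lword lmf /=.
case lmr: (lm le (rest le f)) => [c|] /=; last first.
  split=> // _ b bf ba; have : b \in msupp (rest le f) by rewrite restE bf.
  by rewrite (lm_eq0 lmr) msupp0 in_fset0.
have /lmP[cr cmax] := lmr.
split=> [|dom]; last by apply: dom; move: cr; rewrite restE => /andP[].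
move=> /andP[ca /= cla] b bf ba.
have bc : le (dword b) (dword c) by apply/(mcle_word leP)/cmax; rewrite restE bf.
rewrite /strict (mo_trans leP bc cla) andbT; apply: contra ca => /eqP eba.
by apply/eqP; congr Some; apply: (mo_anti leP); rewrite cla -eba bc.
Qed.

(** The only basis element on a word of length at least 3 has index 1, so no
    other monomial of f can share its leading word. *)
Lemma strong_long f a :
  lm le f = Some a -> (2 < mdeg (dword a))%N -> strong le f.
Proof.
move=> lmf along; have /lmP[_ amax] := lmf.
apply/(strongP lmf) => b /amax ba bNa.
rewrite /strict (mcle_word leP ba) andbT; apply: contra bNa => /eqP eba.
by apply/eqP/dimon_eq; rewrite ?(dindex_long along) // dindex_long ?eba.
Qed.

Lemma mcoeff_dleft f (w : cword X) c :
  (dleft f (dw1 w))@_c =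
  \sum_(a <- msupp f) f@_a *+ (inl (cmul (dword a) w) == c).
Proof.
rewrite /dleft /bilin_ext /dw1 msuppU oner_eq0 (raddf_sum (mcoeff c)).
apply: eq_bigr => a _.
by rewrite big_seq_fset1 mcoeffUU mulr1; apply: mcoeffU.
Qed.

(** Multiplication by w keeps words of f strictly below the leading word, so
    that nothing cancels it.  Strength is needed: if the two symbols on one word
    of length 2 occur in f, left multiplication merges them. *)
Lemma lm_dleft f a (w : cword X) : strong le f -> lm le f = Some a ->
  lm le (dleft f (dw1 w)) = Some (inl (cmul (dword a) w)).
Proof.
move=> fstrong lmf; have /lmP[af amax] := lmf.
have dom := (strongP lmf).1 fstrong.
have wmax b : b \in msupp f ->
    mcle le (inl (cmul (dword b) w) : dimon X) (inl (cmul (dword a) w)).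
  move=> bf; have [->|ba] := eqVneq b a; first exact: mcle_refl.
  by rewrite /mcle (mo_mul leP w (dom b bf ba)).
apply/lmP; split=> [|c].
  rewrite -mcoeff_neq0 mcoeff_dleft (bigD1_seq a) ?fset_uniq //= eqxx mulr1n.
  rewrite big_seq_cond big1 ?addr0 ?(lm_neq0 lmf) // => b /andP[bf bNa].
  case: eqP => // /(congr1 (@dword X))/cmulI eab.
  by have := dom b bf bNa; rewrite /strict eab eqxx.
rewrite -mcoeff_neq0 mcoeff_dleft.
have [/hasP[b bf /eqP<-] _|/hasPn none] :=
    boolP (has (fun b => inl (cmul (dword b) w) == c) (msupp f)).
  exact: wmax.
by case/eqP; rewrite big_seq big1 // => b /none/negPf->.
Qed.

End LeadingMonomial.

(** * Reduction in an ideal *)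

Section Ideals.
Context (k : fieldType) (X : choiceType) (le : rel (cword X)).
Context (leP : monomial_ordering le) (I : Di k X -> Prop) (idI : ideal I).
Implicit Types (f g h p s : Di k X) (S : Di k X -> Prop).

Lemma idealB f g : I f -> I g -> I (f - g).
Proof.
case: idI => _ addI scaleI _ If Ig.
by rewrite -scaleN1r; apply: addI => //; apply: scaleI.
Qed.

Lemma normal_poly_ideal s b m p : I s -> normal_poly le s b m p -> I p.
Proof.
case: idI => _ _ _ mulI Is [a _ //|x _|w _]; first by case: (mulI s (dgen x) Is).
by case: (mulI s (dw1 w) Is).
Qed.

Lemma composition_ideal f g h : I f -> I g -> composition le f g h -> I h.
Proof.
case: (idI) => _ _ _ mulI If Ig.
have Ileft x : I (dleft f (dgen x)) by case: (mulI f (dgen x) If).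
have Iright x : I (dright f (dgen x)) by case: (mulI f (dgen x) If).
by case=> *; try apply: idealB; eauto using normal_poly_ideal.
Qed.

Definition lm_cover S := forall h a, I h -> lm le h = Some a ->
  exists s b m p, [/\ S s, normal_poly le s b m p & lm le p = Some a].

(** Division of h by the normal S-polynomials: subtracting the multiple that
    cancels the leading monomial stays in I, where the induction hypothesis
    applies. *)
Lemma trivial_mod_cover S : (forall s, S s -> I s) -> lm_cover S ->
  forall h, I h -> trivial_mod le S h.
Proof.
move=> SI cover h Ih; have [->|h0] := eqVneq h 0.
  by exists [::]; split=> //; rewrite big_nil.
have [a lmh] := lm_exists leP h0.
elim/(mcle_ind leP): a h Ih lmh {h0} => a IHa h Ih lmh.
have [s [b [m [p [Ss sbp lmp]]]]] := cover h a Ih lmh.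
set c := h@_a / p@_a; pose h' := h - c *: p.
have Ih' : I h'.
  case: (idI) => _ _ scaleI _; apply: idealB => //; apply: scaleI.
  exact: normal_poly_ideal (SI s Ss) sbp.
have below := lm_cancel leP lmh lmp.
have [l [lS h'E]] : trivial_mod le S h'.
  case lmh': (lm le h') => [a'|]; first by have [? ?] := below _ lmh'; apply: IHa lmh'.
  by exists [::]; split=> //; rewrite big_nil (lm_eq0 leP lmh').
exists ((c, p) :: l); split; last by rewrite big_cons /= -h'E addrC subrK.
move=> d q; rewrite inE => /predU1P[[-> ->]|/lS [qS qh']].
  by split; [exists s, b, m | rewrite lmh lmp /= mcle_refl].
split=> // /qh'; rewrite lmh; case: (lm le q) => //= a''.
case lmh': (lm le h') => [a'|] //= a''a'.
by have [_ a'a] := below _ lmh'; apply: mcle_trans a''a' a'a.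
Qed.

End Ideals.

Lemma trivial_mod_ideal_gen (k : fieldType) (X : choiceType)
    (le : rel (cword X)) (S : Di k X -> Prop) h :
  trivial_mod le S h -> ideal_gen S h.
Proof.
case=> l [lS ->] J idJ SJ; case: (idJ) => J0 addJ scaleJ _.
rewrite big_seq; elim/big_ind: _ => // -[c p] /lS[[s [b [m [Ss sbp]]]] _].
exact/scaleJ/(normal_poly_ideal idJ (SJ s Ss) sbp).
Qed.

(** * Finiteness *)

(** Dickson's lemma is applied to the exponents of the leading word together
    with coordinates that record its index and its length truncated at 3. *)
Lemma finite_lm_cover (k : fieldType) (X : finType) (le : rel (cword X))
    (I : Di k X -> Prop) : monomial_ordering le -> ideal I ->
  exists S : {fset Di k X},
    (forall s, s \in S -> I s /\ Defs.monic le s) /\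
    lm_cover le I (fun s : Di k X => s \in S).
Proof.
move=> leP idI.
(* Domination in the first two coordinates means equal indices; the third one,
   against the exponents, lets the length grow only from a length of at least
   3. *)
pose coords : seq (dimon X -> nat) :=
  [:: @dindex X, (fun a => 2 - dindex a)%N, (fun a => 3 - mdeg (dword a))%N &
      [seq (fun a => (dword a : {cmonom X}) x) | x <- enum X]].
(* The default value 0 concerns only the zero polynomial, which is not monic. *)
have [l lP ldom] := dickson [seq oapp e 0%N \o lm le | e <- coords]
                            (fun f => I f /\ Defs.monic le f).
exists [fset f in l]%fset; split=> [s|h a Ih lmh]; first by rewrite inE => /lP.
have ha0 := lm_neq0 leP lmh.
have lmh1 : lm le ((h@_a)^-1 *: h) = Some a by rewrite lmZ ?invr_eq0.
have [|s sl] := ldom ((h@_a)^-1 *: h).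
  split; first by case: idI => _ _ scaleI _; apply: scaleI.
  by rewrite /Defs.monic /lc lmh1 mcoeffZ mulVf.
have [c lms] : exists c, lm le s = Some c.
  apply: (lm_exists leP); case: (lP s sl) => _ smonic.
  apply: contra_eq_neq smonic => ->; rewrite /lc.
  by case: (lm le 0) => [?|]; rewrite ?mcoeff0 eq_sym oner_eq0.
rewrite all_map /= lmh1 lms /= all_map => /and4P[ci1 ci2 cdeg /allP cexp].
have ica : dindex c = dindex a by move: ci1 ci2; case: (c) (a) => [?|?] [?|?].
have [b awE] : exists b, dword a = mmul (dword c : {cmonom X}) b :> {cmonom X}.
  apply: cmonom_dvd => x; have := cexp x (mem_enum _ x).
  by rewrite /= lmh1 lms.
have [b1|bN1] := eqVneq b mone.
  exists s, mone, (dindex c), s; rewrite inE lms; split=> //.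
    exact: NormalUnit.
  congr Some; apply: dimon_eq => //; apply/val_inj; rewrite /= awE b1.
  by rewrite mulm1.
(* The length grows from c to a, so that it is not one of the small lengths
   that the third coordinate preserves. *)
have clong : (2 < mdeg (dword c))%N.
  by move: cdeg; rewrite awE mdegM -mdeg_eq0 in bN1 *; lia.
have sstrong := strong_long leP lms clong.
exists s, b, 1%N, (dleft s (dw1 (CWord bN1))); rewrite inE; split=> //.
  exact: (NormalLeft (CWord bN1)).
rewrite (lm_dleft leP _ sstrong lms); congr Some; apply: dimon_eq.
  by apply/val_inj; rewrite /= awE.
by rewrite -ica (dindex_long clong).
Qed.

Theorem theorem25 (k : fieldType) (X : finType) (I : Di k X -> Prop)
    (le : rel (cword X)) :
  ideal I -> monomial_ordering le ->
  exists S : {fset Di k X},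
    GS_basis_for le (fun f : Di k X => f \in S) I.
Proof.
move=> idI leP; have [S [SP cover]] := finite_lm_cover leP idI.
have SI s : s \in S -> I s by case/SP.
have triv := trivial_mod_cover leP idI SI cover.
exists S; split.
  split=> [s /SP[]//|f g h fS gS fgh].
  exact/triv/(composition_ideal idI (SI f fS) (SI g gS) fgh).
move=> f; split=> [If|]; first exact: trivial_mod_ideal_gen (triv f If).
by apply.
Qed.
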